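(* Let $a,b$ be integers and let $(u_n)_{n\ge 0}$ be the integer sequence with $u_0=0$, $u_1=1$, $u_{n+2}=a u_{n+1}+b u_n$ for all $n\ge 0$, assumed nondegenerate ($b\neq 0$ and the ratio of the two complex roots of $x^2-ax-b$ is not a root of unity). Let $\Delta:=a^2+4b$. Let $k\ge 2$ be an integer with $\gcd(k,b)=1$, with prime factorization $k=p_1^{a_1}\cdots p_h^{a_h}$ ($p_1<\dots<p_h$ primes, $a_i\ge 1$). For each positive integer $n$ define $c_k(n):=\prod_{i=1}^h p_i^{\varrho_{p_i}(n)}$, where for a prime $p\nmid b$ the quantity $\varrho_p(n)$ is defined by $\varrho_2(n):=\nu_2(u_3)$ if $2\nmid\Delta$ and $2\nmid n$; $\varrho_2(n):=\nu_2(u_6)-1$ if $2\nmid \Delta$ and $2\mid n$; $\varrho_2(n):=\nu_2(u_2)-1$ if $2\mid\Delta$; and, for $p\ge 3$, $\varrho_p(n):=\nu_p(u_{\tau(p)})$ if $p\nmid\Delta$; $\varrho_p(n):=\nu_3(u_3)-1$ if $p\mid\Delta$ and $p=3$; $\varrho_p(n):=0$ if $p\mid\Delta$ and $p\ge 5$. Then for every positive integer $n$, $$\nu_k(u_n)=\begin{cases}\nu_k(c_k(n)\,n) & \text{if } \tau(p_1\cdots p_h)\mid n,\\ 0 & \text{if } \tau(p_1\cdots p_h)\nmid n.\end{cases}$$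
   Context: For integers $k\ge 2$ and $m\neq 0$, $\nu_k(m)$ denotes the greatest nonnegative integer $e$ such that $k^e\mid m$; for a prime $p$ this is the usual $p$-adic valuation. For a positive integer $m$ coprime to $b$, $\tau(m)$ (the rank of apparition of $m$) is the least positive integer $n$ with $m\mid u_n$. *)

(* Defs.v *)
From mathcomp Require Import all_boot all_order all_algebra all_field.
From mathcomp Require Import boolp.
Set Implicit Arguments.
Unset Strict Implicit.
Unset Printing Implicit Defensive.
Import Order.TTheory GRing.Theory Num.Theory.
Local Open Scope ring_scope.

(* The roots are taken with multiplicity, so a double root is degenerate
   (ratio 1).  As the coefficients are integers, the complex roots lie in
   [algC].  Positivity of [m] matters: every number is a 0-th root of 1. *)
Definition lucas_nondegenerate (a b : int) : Prop :=
  b != 0 /\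
  forall alpha beta : algC,
    'X^2 - a%:~R *: 'X - b%:~R%:P = ('X - alpha%:P) * ('X - beta%:P) ->
    forall m : nat, (0 < m)%N -> ~~ m.-unity_root (alpha / beta).

(* The greatest [e] such that [k ^+ e] divides [m], for [1 < k] and [m != 0]
   (the bound on [e] loses nothing, see [nu_dvd]); [nu k 0 = 0]. *)
Definition nu (k : nat) (m : int) : nat :=
  \max_(e < `|m|.+1 | (k%:Z ^+ e %| m)%Z) e.

Lemma nu_dvd (k : nat) (m : int) (e : nat) :
  (1 < k)%N -> m != 0 -> (k%:Z ^+ e %| m)%Z = (e <= nu k m)%N.
Proof.
move=> k1 m0; apply/idP/idP => [kem|].
  have lt_e : (e < `|m|.+1)%N.
    rewrite ltnS; apply: leq_trans (ltnW (ltn_expl e k1)) _.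
    apply: dvdn_leq; first by rewrite absz_gt0.
    by move: kem; rewrite dvdzE abszX.
  exact: (leq_bigmax_cond (Ordinal lt_e)).
suff dvd_nu : (k%:Z ^+ nu k m %| m)%Z.
  by move=> le_e; apply: dvdz_trans dvd_nu; apply: dvdz_exp2l.
rewrite /nu; apply: (big_ind (fun e => (k%:Z ^+ e %| m)%Z)) => //.
  by move=> x y Hx Hy; rewrite /maxn; case: ifP.
Qed.

Definition divides_term (u : nat -> int) (m n : nat) : bool :=
  (0 < n)%N && (m%:Z %| u n)%Z.

(* The rank of apparition of [m] in [u]; the value 0 when no term of positive
   index is divisible by [m] never occurs for [m] coprime to [b]. *)
Definition tau (u : nat -> int) (m : nat) : nat :=
  if pselect (exists n, divides_term u m n) is left ex then ex_minn ex else 0%N.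

Definition discr (a b : int) : int := a ^+ 2 + 4 * b.

(* In each branch containing [.-1], if [p] does not divide [b] then [p]
   divides the term of [u] involved (with nonzero value for nondegenerate [u]),
   so that [.-1] is the true predecessor. *)
Definition rho (a b : int) (u : nat -> int) (p n : nat) : nat :=
  if p == 2%N then
    if (2 %| discr a b)%Z then (nu 2 (u 2%N)).-1
    else if odd n then nu 2 (u 3%N)
    else (nu 2 (u 6%N)).-1
  else
    if ~~ (p%:Z %| discr a b)%Z then nu p (u (tau u p))
    else if p == 3%N then (nu 3 (u 3%N)).-1
    else 0%N.

Definition c_k (a b : int) (u : nat -> int) (k n : nat) : nat :=
  (\prod_(p <- primes k) p ^ rho a b u p n)%N.

(* Main.v *)
(* Everything is local at a prime p of k.  The companion matrix M satisfies
   M^m = u_m M + c with c = b u_(m-1); expanding M^(mr) = (u_m M + c)^r and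
   reading off one entry gives u_(mr) = sum_i C(r,i) c^(r-i) u_m^i u_i.  When
   p | u_m, c is prime to p, so this yields the lifting-the-exponent rule
   v_p(u_(mr)) = v_p(u_m) + v_p(r), provided p^2 | u_m^(p-1) u_p (automatic for
   odd p).  It is applied with m = tau(p), or m = 6 when p = 2, a is odd and n
   is even.  Expanding (2M)^p = (a + Y)^p with Y^2 = Delta gives
   2^p u_p = 2p a^(p-1) + 2 Delta^((p-1)/2) modulo p Delta for odd p, which
   settles whether p divides u_p, and that v_p(u_p) = 1 if p | Delta, p >= 5. *)
Require Import Defs.
From mathcomp Require Import all_boot all_order all_algebra all_field.
From mathcomp Require Import boolp ring zify.
Import Order.TTheory GRing.Theory Num.Theory.
Local Open Scope ring_scope.

(** * Integer divisibility and valuations, one prime at a time *)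

Lemma prime_dvdzM (p : nat) (x y : int) :
  prime p -> (p %| x * y)%Z = (p %| x)%Z || (p %| y)%Z.
Proof. by move=> p_pr; rewrite !dvdzE abszM Euclid_dvdM. Qed.

Lemma prime_dvdzX (p : nat) (x : int) (n : nat) :
  prime p -> (p %| x ^+ n)%Z = (p %| x)%Z && (0 < n)%N.
Proof. by move=> p_pr; rewrite !dvdzE abszX Euclid_dvdX. Qed.

Lemma nu_prime (p : nat) (x : int) :
  prime p -> x != 0 -> nu p x = logn p `|x|.
Proof.
move=> p_pr x0.
have dvdE e : (e <= nu p x)%N = (e <= logn p `|x|)%N.
  rewrite -nu_dvd ?prime_gt1 // dvdzE abszX -pfactor_dvdn //.
  by rewrite absz_gt0.
by apply/eqP; rewrite eqn_leq -dvdE leqnn dvdE leqnn.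
Qed.

Lemma logn_abszM (p : nat) (x y : int) : x != 0 -> y != 0 ->
  logn p `|x * y| = (logn p `|x| + logn p `|y|)%N.
Proof. by move=> x0 y0; rewrite abszM lognM // absz_gt0. Qed.

Lemma logn_absz_ndvd (p : nat) (x : int) :
  prime p -> ~~ (p %| x)%Z -> logn p `|x| = 0%N.
Proof.
by move=> p_pr px; apply: logn_coprime; rewrite prime_coprime.
Qed.

Lemma dvdn_logn (k N : nat) : (0 < k)%N -> (0 < N)%N ->
  reflect {in primes k, forall p, logn p k <= logn p N}%N (k %| N)%N.
Proof.
move=> k0 N0; apply: (iffP idP) => [kN p _|lekN]; first exact: dvdn_leq_log.
apply/(dvdn_partP _ k0) => p p_k.
by rewrite p_part pfactor_dvdn ?lekN //; move: p_k;
  rewrite mem_primes => /andP[].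
Qed.

(** For [e > 0], [k ^ e] has the same primes as [k], so whether it divides a nonzero integer depends
    only on the valuations at those primes. This reduces the theorem to one prime at a time. *)
Lemma eq_nu (k : nat) (x y : int) : (1 < k)%N -> x != 0 -> y != 0 ->
  {in primes k, forall p, logn p `|x| = logn p `|y|} -> nu k x = nu k y.
Proof.
move=> k1 x0 y0 eqxy; have k0 := ltnW k1.
have dvdE e : (e <= nu k x)%N = (e <= nu k y)%N.
  rewrite -!nu_dvd // !dvdzE !abszX.
  case: e => [|e]; first by rewrite !dvd1n.
  by apply/dvdn_logn/dvdn_logn; rewrite ?expn_gt0 ?k0 ?absz_gt0 // => H p;
    move=> p_k; have := H p p_k; rewrite eqxy // -(primesX k (ltn0Sn e)).
by apply/eqP; rewrite eqn_leq -dvdE leqnn dvdE leqnn.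
Qed.

Lemma nu_ndvd (k : nat) (x : int) :
  (1 < k)%N -> x != 0 -> ~~ (k %| x)%Z -> nu k x = 0%N.
Proof. by move=> k1 x0; rewrite -[k%:Z]expr1 nu_dvd // -eqn0Ngt => /eqP. Qed.

Lemma logn_prod_primes (k p : nat) (f : nat -> nat) : p \in primes k ->
  logn p (\prod_(q <- primes k) q ^ f q)%N = f p.
Proof.
move=> p_k; have p_pr: prime p by move: p_k; rewrite mem_primes => /andP[].
have q_pr q : q \in primes k -> prime q by rewrite mem_primes => /andP[].
rewrite (perm_big _ (perm_to_rem p_k)) big_cons /=.
have rest_gt0 : (0 < \prod_(q <- rem p (primes k)) q ^ f q)%N.
  rewrite big_seq; apply: prodn_cond_gt0 => q /mem_rem /q_pr q_gt0.
  by rewrite expn_gt0 prime_gt0.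
have pf_gt0 : (0 < p ^ f p)%N by rewrite expn_gt0 prime_gt0.
rewrite (lognM p pf_gt0 rest_gt0) lognX logn_prime // eqxx muln1
  logn_coprime ?addn0 //.
rewrite big_seq; elim/big_ind: _ => [|x y cx cy|q].
- exact: coprimen1.
- by rewrite coprimeMr cx.
rewrite mem_rem_uniq ?primes_uniq // inE => /andP[neq /q_pr qpr].
by apply: coprimeXr; rewrite prime_coprime // dvdn_prime2 // eq_sym.
Qed.

Lemma dvdz_prod_primes (k : nat) (x : int) :
  ((\prod_(p <- primes k) p)%N %| x)%Z =
    all (fun p : nat => (p%:Z %| x)%Z) (primes k).
Proof.
have [->|x0] := eqVneq x 0.
  by rewrite dvdz0; apply/esym/allP => p _; apply: dvdz0.
have primes_P q : q \in primes k -> prime q by rewrite mem_primes => /andP[].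
have P_gt0 : (0 < \prod_(p <- primes k) p)%N.
  by rewrite big_seq; apply: prodn_cond_gt0 => q /primes_P/prime_gt0.
have EP p : p \in primes k -> logn p (\prod_(q <- primes k) q)%N = 1%N.
  move=> p_k; exact: (logn_prod_primes k p (fun=> 1%N)).
apply/idP/allP => [Px q q_k|H].
  apply: dvdz_trans Px; rewrite dvdzE /= (big_rem q) //=.
  exact: dvdn_mulr.
rewrite dvdzE /=; apply/dvdn_logn => //; first by rewrite absz_gt0.
move=> p; rewrite mem_primes P_gt0 /= => /andP[p_pr].
rewrite Euclid_dvd_prod // big_has => /hasP[q q_k].
rewrite dvdn_prime2 // ?primes_P // => /eqP pq; rewrite pq.
rewrite EP // logn_gt0 mem_primes primes_P //= absz_gt0 x0 /=.
exact: H.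
Qed.

(** For [1 < i < p] the binomial coefficient supplies a factor [p] and [f i] a factor [d]. Used with
    [d = u m.+1 ^+ 2] and with [d = discr a b]. *)
Lemma binomial_sum_prime (p : nat) (d : int) (f : nat -> int) :
  prime p -> f 0%N = 0 -> (forall i, (1 < i < p)%N -> (d %| f i)%Z) ->
  (p%:Z * d %| \sum_(i < p.+1) 'C(p, i)%:Z * f i - p%:Z * f 1%N - f p)%Z.
Proof.
case: p => [|[|p]] // p_pr f0 df.
rewrite big_ord_recl big_ord_recr big_ord_recl f0 /= /bump /= !add1n bin1 binn.
have cancel (x y z : int) : x + y + z - x - z = y by ring.
rewrite mulr0 add0r mul1r cancel.
apply: rpred_sum => i _; rewrite dvdz_mul // ?df //= ?dvdzE /=.
  by rewrite prime_dvd_bin //= ltnS; have := ltn_ord i; lia.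
by have := ltn_ord i; rewrite /bump /=; lia.
Qed.

(** Nondegeneracy speaks of factorizations of the polynomial, so one has to be exhibited; the sum
    and product of the roots feed Binet's formula. *)
Lemma quadratic_roots (C : numClosedFieldType) (s t : C) :
  exists alpha beta, [/\ alpha + beta = s, alpha * beta = - t &
    'X^2 - s *: 'X - t%:P = ('X - alpha%:P) * ('X - beta%:P)].
Proof.
pose d := sqrtC (s ^+ 2 + 4 * t).
have d2 : d ^+ 2 = s ^+ 2 + 4 * t by rewrite sqrtCK.
have add_st : (s + d) / 2 + (s - d) / 2 = s by field.
have mul_st : (s + d) / 2 * ((s - d) / 2) = - t.
  have -> : (s + d) / 2 * ((s - d) / 2) = (s ^+ 2 - d ^+ 2) / 4 by field.
  by rewrite d2; field.
exists ((s + d) / 2), ((s - d) / 2); split=> //.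
move: add_st mul_st; move: (_ / 2) (_ / 2) => alpha beta <- mul_st.
by rewrite -[t]opprK -mul_st -mul_polyC polyCD polyCN polyCM; ring.
Qed.

Lemma dvdz_congr (d x y : int) : (d %| x - y)%Z -> (d %| x)%Z = (d %| y)%Z.
Proof. by move=> dxy; rewrite -[x](subrK y) rpredDl. Qed.

Lemma logn_id (p : nat) : prime p -> logn p p = 1%N.
Proof. by move=> p_pr; rewrite logn_prime // eqxx. Qed.

Lemma dvdz2_addNN (x y : int) :
  ~~ (2 %| x)%Z -> ~~ (2 %| y)%Z -> (2 %| x + y)%Z.
Proof. lia. Qed.

(** * Powers of the companion matrix and binomial expansions *)

Definition companion (a b : int) : 'M[int]_2 :=
  \matrix_(i < 2, j < 2)
    if i == 0 then (if j == 0 then a else b) else (j == 0)%:R.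

Lemma companion_sqr (a b : int) :
  companion a b ^+ 2 = a *: companion a b + b%:A.
Proof.
apply/matrixP => i j; rewrite expr2 mxE big_ord_recl big_ord1 !mxE /=.
case: i => [[|[|i]] //= ?]; case: j => [[|[|j]] //= ?]; rewrite /eq_op /=; ring.
Qed.

Section Lucas.
Variables (a b : int) (u : nat -> int).
Hypotheses (u0 : u 0%N = 0) (u1 : u 1%N = 1).
Hypothesis u_rec : forall n : nat, u n.+2 = a * u n.+1 + b * u n.

Let M := companion a b.

Lemma companionX (n : nat) : M ^+ n.+1 = u n.+1 *: M + (b * u n)%:A.
Proof.
elim: n => [|n IH]; first by rewrite u0 u1 mulr0 scale0r addr0 scale1r.
rewrite exprS IH mulrDr -!scalerAr mulr1 -expr2 companion_sqr u_rec.
rewrite scalerDr !scalerA addrAC -scalerDl; congr (_ *: _ + _ *: _); ring.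
Qed.

Lemma companionX_10 (n : nat) : (M ^+ n) 1 0 = u n.
Proof.
case: n => [|n]; first by rewrite expr0 mxE u0.
by rewrite companionX !mxE /= mulr1 mulr0 addr0.
Qed.

Lemma lucas_mul (m r : nat) :
  u (m.+1 * r) =
  \sum_(i < r.+1) 'C(r, i)%:Z * ((b * u m) ^+ (r - i) * u m.+1 ^+ i * u i).
Proof.
rewrite -companionX_10 exprM companionX addrC exprDn_comm; last first.
  exact: comm_alg.
rewrite summxE; apply: eq_bigr => i _.
rewrite !exprZn expr1n -scalerAl mul1r -scaler_nat !scalerA mxE.
by rewrite companionX_10 natz !mulrA.
Qed.

(** In [lucas_mul] the term [i = 0] vanishes with [u 0], and the terms with [i >= 2] contain the
    square of [u m.+1]. *)
Lemma lucas_mul_mod (m r : nat) :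
  (u m.+1 ^+ 2 %| u (m.+1 * r) - r%:Z * (b * u m) ^+ r.-1 * u m.+1)%Z.
Proof.
case: r => [|r]; first by rewrite muln0 u0 !mul0r subr0 dvdz0.
rewrite lucas_mul !big_ord_recl u0 !mulr0 add0r /= /bump /= addn0 bin1 u1.
rewrite mulr1 subn1 /= expr1 mulrA [_ + \sum_(_ < _) _]addrC addrK.
apply: rpred_sum => i _.
by rewrite dvdz_mull // dvdz_mulr // dvdz_mull // dvdz_exp2l.
Qed.

Lemma lucas_mul_prime_mod (m p : nat) : prime p ->
  (p%:Z * u m.+1 ^+ 2 %| u (m.+1 * p)
     - p%:Z * ((b * u m) ^+ p.-1 * u m.+1) - u m.+1 ^+ p * u p)%Z.
Proof.
move=> p_pr; rewrite lucas_mul.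
pose f i := (b * u m) ^+ (p - i) * u m.+1 ^+ i * u i.
have <- : f 1%N = (b * u m) ^+ p.-1 * u m.+1.
  by rewrite /f u1 mulr1 subn1 expr1.
have <- : f p = u m.+1 ^+ p * u p by rewrite /f subnn expr0 mul1r.
apply: binomial_sum_prime => //.
  by rewrite /f u0 mulr0.
by move=> [|[|i]] // _; rewrite /f dvdz_mulr // dvdz_mull // dvdz_exp2l.
Qed.

(** Completing the square: [Y] has trace zero, so its square is scalar. *)
Let Y : 'M[int]_2 := 2 *: M - a%:A.

Lemma companion_disc : Y ^+ 2 = (discr a b)%:A.
Proof.
rewrite expr2 mulrBl !mulrBr -!scalerAl -!scalerAr !mul1r !mulr1 -expr2.
rewrite companion_sqr /discr; apply/matrixP => i j; rewrite !mxE; ring.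
Qed.

(** Even powers of [Y] are scalar and vanish off the diagonal; odd ones are [discr a b ^+ i./2]
    times [Y], whose lower left entry is 2. *)
Lemma lucas_pow2 (p : nat) :
  2 ^+ p * u p = \sum_(i < p.+1) 'C(p, i)%:Z *
    (a ^+ (p - i) * (2 * (discr a b ^+ i./2 *+ odd i))).
Proof.
have <- : ((a%:A + Y) ^+ p) 1 0 = 2 ^+ p * u p.
  by rewrite addrC subrK exprZn mxE companionX_10.
rewrite exprDn_comm; last first.
  exact: comm_alg.
rewrite summxE; apply: eq_bigr => i _.
rewrite exprZn expr1n -scalerAl mul1r -scaler_nat scalerA mxE.
rewrite natz -mulrA; congr (_ * (_ * _)).
rewrite -{1}(odd_double_half i) exprD -muln2 mulnC exprM companion_disc.
rewrite exprZn expr1n -scalerAr mulr1 mxE mulrC.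
case: (odd i); last by rewrite expr0 mxE mul0r mulr0.
by rewrite expr1 !mxE /= mulr1 mulr0 subr0.
Qed.

Lemma lucas_prime_mod (p : nat) : prime p -> odd p ->
  (p%:Z * discr a b %| 2 ^+ p * u p - p%:Z * (2 * a ^+ p.-1)
     - 2 * discr a b ^+ p./2)%Z.
Proof.
move=> p_pr p_odd; rewrite lucas_pow2.
pose f i := a ^+ (p - i) * (2 * (discr a b ^+ i./2 *+ odd i)).
have <- : f 1%N = 2 * a ^+ p.-1 by rewrite /f subn1 expr0 mulr1n mulr1 mulrC.
have <- : f p = 2 * discr a b ^+ p./2.
  by rewrite /f subnn p_odd expr0 mul1r mulr1n.
apply: binomial_sum_prime => //; first by rewrite /f mulr0n !mulr0.
move=> [|[|i]] // _; rewrite /f dvdz_mull // dvdz_mull // rpredMn //=.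
by rewrite exprS dvdz_mulr.
Qed.

(** * Classical identities and nonvanishing *)

Lemma lucas_cassini (n : nat) : u n.+1 ^+ 2 - u n.+2 * u n = (- b) ^+ n.
Proof.
elim: n => [|n IH]; first by rewrite u0 u1; ring.
by rewrite [RHS]exprS -IH [u n.+3]u_rec u_rec; ring.
Qed.

Lemma lucas_add (m n : nat) :
  u (m.+1 + n) = u m.+1 * u n.+1 + b * u m * u n.
Proof.
elim: n m => [|n IH] m; first by rewrite addn0 u0 u1; ring.
by rewrite addnS -addSn IH !u_rec; ring.
Qed.

Lemma lucas_binet (R : comNzRingType) (alpha beta : R) :
  alpha + beta = a%:~R -> alpha * beta = - b%:~R ->
  forall n, (u n)%:~R * (alpha - beta) = alpha ^+ n - beta ^+ n.
Proof.
move=> ab_add ab_mul n.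
suff [] : (u n)%:~R * (alpha - beta) = alpha ^+ n - beta ^+ n /\
  (u n.+1)%:~R * (alpha - beta) = alpha ^+ n.+1 - beta ^+ n.+1 by [].
elim: n => [|n [IH0 IH1]]; first by rewrite u0 u1 subrr mul0r mul1r.
split=> //; rewrite u_rec rmorphD !rmorphM /= mulrDl -!mulrA IH0 IH1 -ab_add.
by rewrite -[b%:~R]opprK -ab_mul !exprS; ring.
Qed.

(** If [u n = 0], Binet's formula gives [alpha ^+ n = beta ^+ n], which makes the ratio of the roots
    an [n]-th root of unity. *)
Lemma lucas_neq0 (n : nat) : lucas_nondegenerate a b -> (0 < n)%N -> u n != 0.
Proof.
move=> [b0 nondeg] n0; apply/negP => /eqP un0.
have [alpha [beta [ab_add ab_mul polyE]]] :=
  @quadratic_roots algC a%:~R b%:~R.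
have beta0 : beta != 0.
  apply: contraNneq b0 => beta0; move: ab_mul; rewrite beta0 mulr0 => /eqP.
  by rewrite eq_sym oppr_eq0 intr_eq0.
have := nondeg _ _ polyE n n0; rewrite unity_rootE expr_div_n.
have /eqP := lucas_binet _ _ _ ab_add ab_mul n.
rewrite un0 mul0r eq_sym subr_eq0 => /eqP ->.
by rewrite divff ?expf_neq0 // eqxx.
Qed.

(** * Rank of apparition *)

Lemma coprimez_congr (m x y : int) :
  (m %| x - y)%Z -> coprimez m x = coprimez m y.
Proof.
rewrite -eqz_mod_dvd => /eqP xy.
by rewrite /coprimez -gcdz_modr xy gcdz_modr.
Qed.

(** Modulo [m], Cassini's identity becomes [- (u n.+2 * u n) = (- b) ^+ n], and the right side is
    prime to [m]. *)
Lemma coprime_lucas_pred (m : int) (n : nat) :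
  coprimez m b -> (m %| u n.+1)%Z -> coprimez m (u n).
Proof.
move=> mb mun; have : coprimez m (u n.+2 * u n).
  rewrite (@coprimez_congr _ _ (- (- b) ^+ n)) ?coprimezN ?coprimezXr
    ?coprimezN //.
  by rewrite -lucas_cassini opprK addrC subrK dvdz_exp.
by rewrite coprimezMr => /andP[].
Qed.

(** As [b] is invertible modulo [m], the recurrence runs backwards: two congruent consecutive pairs
    can be shifted down until one starts at [u 0 = 0]. *)
Lemma lucas_period_back (m : int) (i d : nat) : coprimez m b ->
  (m %| u (i + d) - u i)%Z -> (m %| u (i.+1 + d) - u i.+1)%Z -> (m %| u d)%Z.
Proof.
move=> mb; elim: i => [|i IH]; first by rewrite add0n u0 subr0.
move=> H1 H2; apply: IH => //; rewrite -(Gauss_dvdzr _ mb).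
have -> : b * (u (i + d) - u i) =
  (u (i.+2 + d) - u i.+2) - a * (u (i.+1 + d) - u i.+1).
  by rewrite !addSn !u_rec; ring.
by rewrite rpredB // dvdz_mull.
Qed.

(** Pigeonhole: among [m ^ 2 + 1] pairs of residues of consecutive terms two coincide, and [m]
    divides the term whose index is their distance. *)
Lemma lucas_apparition (m : nat) :
  (0 < m)%N -> coprimez m b -> exists n, divides_term u m n.
Proof.
case: m => // m _ mb.
pose res x : 'I_m.+1 := inord `|(x %% m.+1)%Z|.
pose f (i : 'I_(m.+1 * m.+1).+1) := (res (u i), res (u i.+1)).
have res_inj x y : res x = res y -> (m.+1 %| x - y)%Z.
  move/(congr1 val) => /=.
  have absz_lt z : (`|(z %% m.+1)%Z| < m.+1)%N.
    by rewrite -ltz_nat gez0_abs ?modz_ge0 // ltz_pmod.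
  rewrite !inordK ?absz_lt // => /(congr1 Posz).
  by rewrite !gez0_abs ?modz_ge0 // -eqz_mod_dvd => ->.
have /injectivePn[i [j neq_ij eq_f]] : ~~ injectiveb f.
  apply/negP => /injectiveP /leq_card.
  by rewrite card_prod !card_ord ltnn.
wlog lt_ij : i j neq_ij eq_f / (i < j)%N.
  move=> H; case: (ltngtP i j) => [|lt_ji|/val_inj eq_ij]; first exact: H.
  - by apply: (H j i) => //; rewrite eq_sym.
  - by rewrite eq_ij eqxx in neq_ij.
case: eq_f => /esym/res_inj H1 /esym/res_inj H2.
exists (j - i)%N; rewrite /divides_term subn_gt0 lt_ij /=.
by apply: (@lucas_period_back _ i) => //; rewrite ?addSn subnKC // ltnW.
Qed.

(** With [t] the rank, [lucas_add] gives [u (t + r) = b * u t.-1 * u r] modulo [m], with an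
    invertible coefficient. Hence divisibility depends only on [n] modulo [t], and minimality of [t]
    excludes nonzero remainders. *)
Lemma tau_dvdP (m n : nat) : (0 < m)%N -> coprimez m b ->
  (m %| u n)%Z = (tau u m %| n)%N.
Proof.
move=> m0 mb; rewrite /tau; case: pselect => [ex|]; last first.
  by case; apply: lucas_apparition.
case: ex_minnP => t /andP[t0 mt] t_min.
have shift r : (m %| u (t + r))%Z = (m %| u r)%Z.
  case: t t0 mt {t_min} => // t _ mt.
  rewrite lucas_add rpredDl; last exact: dvdz_mulr.
  by rewrite Gauss_dvdzr // coprimezMr mb coprime_lucas_pred.
have -> : (m %| u n)%Z = (m %| u (n %% t))%Z.
  rewrite {1}(divn_eq n t); elim: (n %/ t)%N => [//|q IH].
  by rewrite mulSn -addnA shift.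
rewrite /dvdn; case: posnP => [->|r0]; first by rewrite u0 dvdz0.
apply/negP => mr.
have := t_min (n %% t)%N; rewrite /divides_term r0 mr => /(_ isT).
by rewrite leqNgt ltn_pmod.
Qed.

Lemma tau_gt0 (m : nat) : (0 < m)%N -> coprimez m b -> (0 < tau u m)%N.
Proof.
move=> m0 mb; rewrite /tau; case: pselect => [ex|]; last first.
  by case; apply: lucas_apparition.
by case: ex_minnP => t /andP[].
Qed.

(** The rank divides the prime [q], and it is not 1 because [u 1 = 1]. *)
Lemma tau_prime (p q : nat) : prime p -> prime q -> coprimez p b ->
  (p %| u q)%Z -> tau u p = q.
Proof.
move=> p_pr q_pr pb; rewrite (tau_dvdP _ _ (prime_gt0 p_pr) pb).
suff tau1 : tau u p != 1%N by move/(prime_nt_dvdP q_pr tau1).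
apply/eqP => tau1; have := tau_dvdP p 1 (prime_gt0 p_pr) pb.
by rewrite tau1 u1 dvdzE /= dvdn1 => /eqP pE; rewrite pE in p_pr.
Qed.

(** Modulo [p], [lucas_prime_mod] leaves [2 ^+ p * u p = 2 * discr a b ^+ p./2], where 2 is
    invertible and the exponent [p./2] is positive. *)
Lemma lucas_prime_dvd (p : nat) : prime p -> odd p ->
  (p %| u p)%Z = (p %| discr a b)%Z.
Proof.
move=> p_pr p_odd; have p2 : (p%:Z %| 2)%Z = false.
  by rewrite dvdzE /= dvdn_prime2 //; case: eqP p_odd => // ->.
have p_half : (0 < p./2)%N by case: (p) p_pr p_odd => [|[|[]]].
have : (p %| 2 ^+ p * u p - 2 * discr a b ^+ p./2)%Z.
  have := dvdz_trans (dvdz_mulr (discr a b) (dvdzz p))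
    (lucas_prime_mod p p_pr p_odd).
  by rewrite addrAC rpredBr // dvdz_mulr.
move/dvdz_congr; rewrite !prime_dvdzM // !prime_dvdzX // p2 /=.
by rewrite p_half andbT.
Qed.

(** * Lifting the exponent at a prime not dividing [b] *)

Section Valuation.
Hypothesis u_neq0 : forall n, (0 < n)%N -> u n != 0.
Variable p : nat.
Hypotheses (p_pr : prime p) (p_b : coprimez p b).

Lemma lucas_dvd_mul (m r : nat) : (u m %| u (m * r))%Z.
Proof.
case: m => [|m]; first by rewrite mul0n u0.
have := dvdz_trans (dvdz_exp2l _ (isT : (1 <= 2)%N)) (lucas_mul_mod m r).
by rewrite expr1 => /dvdz_congr ->; rewrite dvdz_mull.
Qed.

Lemma ndvd_coef (m r : nat) : (p %| u m.+1)%Z -> ~~ (p %| (b * u m) ^+ r)%Z.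
Proof.
move=> pum; rewrite dvdzE -prime_coprime //; apply: (@coprimezXr _ p).
by rewrite coprimezMr p_b coprime_lucas_pred.
Qed.

(** Dividing [u (m * r)] by [u m] leaves [r * (b * u m.-1) ^+ r.-1] modulo [p], a product of
    units. *)
Lemma logn_lucas_mul_coprime (m r : nat) : (0 < m)%N -> (p %| u m)%Z ->
  coprime p r -> logn p `|u (m * r)| = logn p `|u m|.
Proof.
case: m => // m _ pum; rewrite prime_coprime // => p_r.
have r0 : (0 < r)%N by case: (r) p_r => //; rewrite dvdn0.
have /dvdzP[q /eqP] := lucas_mul_mod m r.
rewrite subr_eq => /eqP E.
have {}E : u (m.+1 * r) = u m.+1 * (r%:Z * (b * u m) ^+ r.-1 + q * u m.+1).
  by rewrite E; ring.
have ndvd : ~~ (p %| r%:Z * (b * u m) ^+ r.-1 + q * u m.+1)%Z.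
  rewrite rpredDr; last exact: dvdz_mull.
  by rewrite prime_dvdzM // negb_or {1}dvdzE /= p_r ndvd_coef.
have unz : u (m.+1 * r) != 0 by apply: u_neq0; rewrite muln_gt0.
move: unz; rewrite E mulf_eq0 negb_or => /andP[um0 fac0].
by rewrite logn_abszM // (logn_absz_ndvd _ _ p_pr ndvd) addn0.
Qed.

(** The quotient of [u (m * p)] by [p * u m] is the unit [(b * u m.-1) ^+ p.-1] modulo [p]; the
    hypothesis on [p ^+ 2] makes the last binomial term, [u m ^+ p * u p], harmless. *)
Lemma logn_lucas_mul_prime (m : nat) : (0 < m)%N -> (p %| u m)%Z ->
  (p%:Z ^+ 2 %| u m ^+ p.-1 * u p)%Z ->
  logn p `|u (m * p)| = (logn p `|u m|).+1.
Proof.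
case: m => // m _ pum /dvdzP[s sE].
have /dvdzP[q /eqP] := lucas_mul_prime_mod m p p_pr.
rewrite !subr_eq => /eqP E; have p_gt0 := prime_gt0 p_pr.
pose w := (b * u m) ^+ p.-1 + (q * u m.+1 + s * p%:Z).
have {}E : u (m.+1 * p) = u m.+1 * (p%:Z * w).
  have up : u m.+1 ^+ p * u p = u m.+1 * (s * p%:Z ^+ 2).
    by rewrite -{1}(prednK p_gt0) exprS -mulrA sE.
  by rewrite E up /w; ring.
have ndvd : ~~ (p %| w)%Z.
  by rewrite rpredDr ?ndvd_coef // rpredD // dvdz_mull.
have unz : u (m.+1 * p) != 0 by apply: u_neq0; rewrite muln_gt0.
move: unz; rewrite E !mulf_eq0 !negb_or => /and3P[um0 pz0 w0].
rewrite !logn_abszM ?mulf_neq0 // (logn_absz_ndvd _ _ p_pr ndvd).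
by rewrite /= logn_id // addn0 addn1.
Qed.

(* The last hypothesis fails only for [p = 2] with [u 2] odd and
   [u m = 2] modulo 4; there doubling [m] can raise the valuation by more
   than one. *)
Lemma logn_lucas_mul (m r : nat) : (0 < m)%N -> (0 < r)%N -> (p %| u m)%Z ->
  (p%:Z ^+ 2 %| u m ^+ p.-1 * u p)%Z ->
  logn p `|u (m * r)| = (logn p `|u m| + logn p r)%N.
Proof.
move=> m0 r0 pum H; have [r' co_r' {1}->] := pfactor_coprime p_pr r0.
set e := logn p r; rewrite [(r' * _)%N]mulnC mulnA.
have p_gt0 := prime_gt0 p_pr.
rewrite logn_lucas_mul_coprime ?muln_gt0 ?m0 ?expn_gt0 ?p_gt0 //; last first.
  exact: dvdz_trans pum (lucas_dvd_mul _ _).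
elim: e => [|e IH]; first by rewrite muln1 addn0.
rewrite expnSr mulnA logn_lucas_mul_prime ?IH ?addnS //.
- by rewrite muln_gt0 m0 expn_gt0 p_gt0.
- exact: dvdz_trans pum (lucas_dvd_mul _ _).
(* The hypothesis on [p ^+ 2] passes to multiples of [m], since [u m] divides their terms. *)
apply: dvdz_trans H _; rewrite dvdz_mul // dvdz_exp2r //.
exact: lucas_dvd_mul.
Qed.

(** Here [p.-1 >= 2], so [u m ^+ p.-1] alone supplies the factor [p ^+ 2]. *)
Lemma logn_lucas_mul_odd (m r : nat) : odd p -> (0 < m)%N -> (0 < r)%N ->
  (p %| u m)%Z -> logn p `|u (m * r)| = (logn p `|u m| + logn p r)%N.
Proof.
move=> p_odd m0 r0 pum; apply: logn_lucas_mul => //.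
rewrite dvdz_mulr // (dvdz_trans (dvdz_exp2r 2 pum)) // dvdz_exp2l //.
by case: (p) p_pr p_odd => [|[|[]]].
Qed.

(* If [tau u p = m * p], the expansion gives [u (m * p) = u m ^ p * u p]
   modulo [p], and [p] does not divide [u p], so [p] already divides [u m]. *)
Lemma coprime_tau : odd p -> ~~ (p %| discr a b)%Z -> coprime p (tau u p).
Proof.
move=> p_odd pD; have p_gt0 := prime_gt0 p_pr.
rewrite prime_coprime //; apply/negP => /dvdnP[[|m] tauE].
  by have := tau_gt0 p p_gt0 p_b; rewrite tauE.
have := tau_dvdP p (tau u p) p_gt0 p_b; rewrite dvdnn {1}tauE => pu.
have : (p %| u m.+1 ^+ p * u p)%Z.
  have := dvdz_trans (dvdz_mulr _ (dvdzz p)) (lucas_mul_prime_mod m p p_pr).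
  rewrite addrAC rpredBr; last by rewrite dvdz_mulr.
  by rewrite rpredBl.
rewrite prime_dvdzM // lucas_prime_dvd // (negbTE pD) orbF.
rewrite prime_dvdzX // => /andP[+ _].
rewrite (tau_dvdP p _ p_gt0 p_b) tauE => /dvdn_leq => /(_ isT).
by rewrite leqNgt ltn_Pmulr ?prime_gt1.
Qed.

(** Were [p ^+ 2] to divide [u p], [lucas_prime_mod] would make it divide [p * (2 * a ^+ p.-1)]; but
    [p] is odd, and it cannot divide [a] without dividing [4 * b]. *)
Lemma logn_lucas_disc : (5 <= p)%N -> (p %| discr a b)%Z ->
  logn p `|u p| = 1%N.
Proof.
move=> p5 pD; have p_gt0 := prime_gt0 p_pr.
have p_odd : odd p by case: (even_prime p_pr) p5 => // ->.
have p2 : (p%:Z %| 2)%Z = false.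
  by rewrite dvdzE /= dvdn_prime2 //; case: eqP p5 => // ->.
have pa : ~~ (p %| a)%Z.
  apply/negP => pa; move: pD; rewrite /discr rpredDl; last by rewrite dvdz_exp.
  rewrite (_ : 4 = 2 * 2) // -mulrA !prime_dvdzM // p2 /=.
  move: p_b; rewrite coprimezE /= prime_coprime //.
  by move/negP.
have pu : (p %| u p)%Z by rewrite lucas_prime_dvd.
have up0 := u_neq0 p p_gt0.
apply/eqP; rewrite eqn_leq logn_gt0 mem_primes p_pr absz_gt0 up0 [(p %| _)%N]pu.
rewrite !andbT leqNgt -pfactor_dvdn ?absz_gt0 //.
apply/negP => p2u.
have {p2u}pu2 : (p%:Z ^+ 2 %| u p)%Z by rewrite dvdzE abszX.
have /dvdzP[d dE] := pD.
have : (p%:Z ^+ 2 %| p%:Z * (2 * a ^+ p.-1))%Z.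
  have pD2 : (p%:Z ^+ 2 %| p%:Z * discr a b)%Z by rewrite expr2 dvdz_mul.
  have := dvdz_trans pD2 (lucas_prime_mod p p_pr p_odd).
  rewrite rpredBr; last first.
    rewrite dvdz_mull // (dvdz_trans (dvdz_exp2r 2 pD)) // dvdz_exp2l //.
    (* From [p >= 5] the exponent [p./2] is at least 2; for [p = 3] it is only 1. *)
    exact: (half_leq p5).
  by rewrite rpredBl // dvdz_mull.
rewrite expr2 dvdz_mul2l ?prime_dvdzM ?p2 //= ?prime_dvdzX ?(negbTE pa) //.
by rewrite eqz_nat -lt0n.
Qed.

(** The exponent is lifted from the rank of [p], or from 6 when [p = 2], [a] is odd and [n] is even.
    If that starting index contains a factor [p], it is counted in [logn p n], and the predecessor
    or the value 0 in [rho] compensates. *)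
Lemma logn_lucas (n : nat) : (0 < n)%N -> (p %| u n)%Z ->
  logn p `|u n| = (rho a b u p n + logn p n)%N.
Proof.
move=> n0 pun; have p_gt0 := prime_gt0 p_pr.
have := pun; rewrite (tau_dvdP p n p_gt0 p_b) => /dvdnP[r].
rewrite mulnC => nE.
have r0 : (0 < r)%N by move: n0; rewrite nE muln_gt0 => /andP[].
have nu_u m : (0 < m)%N -> nu p (u m) = logn p `|u m|.
  by move=> m0; rewrite nu_prime // u_neq0.
have logn_u_gt0 m : (0 < m)%N -> (p %| u m)%Z -> (0 < logn p `|u m|)%N.
  by move=> m0 pum; rewrite logn_gt0 mem_primes p_pr absz_gt0 u_neq0.
rewrite /rho; case: eqP => [p2|/eqP p2]; last first.
  have p_odd : odd p by case: (even_prime p_pr) p2 => [->|].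
  case: ifPn => [pD|]; last rewrite negbK => pD.
    have tau0 := tau_gt0 p p_gt0 p_b.
    rewrite nu_u // nE logn_lucas_mul_odd //; last first.
      by rewrite (tau_dvdP p _ p_gt0 p_b).
    by rewrite lognM // [logn p (tau _ _)]logn_coprime // coprime_tau.
  have pup : (p %| u p)%Z by rewrite lucas_prime_dvd.
  have logp := logn_id p p_pr.
  rewrite nE (tau_prime p p) // logn_lucas_mul_odd // lognM // logp.
  case: eqP => [p3|/eqP p3].
    by rewrite -p3 nu_u // !addnA !addn1 prednK ?logn_u_gt0.
  rewrite logn_lucas_disc //.
  by case: (p) p_pr p_odd p2 p3 => [|[|[|[|[|]]]]].
have nu2_u m : (0 < m)%N -> nu 2 (u m) = logn p `|u m|.
  by move=> m0; rewrite -nu_u // p2.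
have u2 : u 2%N = a by rewrite u_rec u0 u1; ring.
have u3 : u 3%N = a ^+ 2 + b by rewrite !u_rec u0 u1; ring.
(* For odd [a] both [u 3] and [u 3 + 2 * b] are even, so 4 divides [u 6], as lifting from 6
   requires. *)
have u6 : u 6%N = u 3%N * (a * (u 3%N + 2 * b)).
  by rewrite !u_rec u0 u1; ring.
have b_odd : ~~ (2 %| b)%Z.
  by move: p_b; rewrite p2 coprimezE /= prime_coprime.
have disc_a : (2 %| discr a b)%Z = (2 %| a)%Z.
  by rewrite /discr rpredDr ?(prime_dvdzX 2 a 2) ?andbT // dvdz_mulr.
rewrite disc_a; case: ifPn => [a_even|a_odd].
  have pup : (p %| u p)%Z by rewrite p2 u2.
  rewrite nE (tau_prime p p) // logn_lucas_mul //; last first.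
    by rewrite p2 u2 expr1 dvdz_mul.
  by rewrite lognM // logn_id // nu2_u // -p2 !addnA !addn1 prednK ?logn_u_gt0.
have u3_even : (2 %| u 3%N)%Z.
  by rewrite u3 dvdz2_addNN // prime_dvdzX // (negbTE a_odd).
have pu3 : (p %| u 3%N)%Z by rewrite p2.
rewrite (tau_prime p 3) // in nE.
case: ifPn => [n_odd|].
  (* The multiplier [r] is odd too, so no doubling from index 3 occurs. *)
  have n_co : coprime p n by rewrite p2 coprime2n.
  have r_co : coprime p r by move: n_co; rewrite nE coprimeMr => /andP[].
  by rewrite nu2_u // (logn_coprime n_co) addn0 nE logn_lucas_mul_coprime.
rewrite nE oddM /= -dvdn2 => /dvdnP[s rE].
have s0 : (0 < s)%N by move: r0; rewrite rE muln_gt0 => /andP[].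
have u6_dvd : (2 ^+ 2 %| u 6%N)%Z.
  by rewrite u6 expr2 dvdz_mul // dvdz_mull // rpredD // dvdz_mulr.
have pu6 : (p %| u 6%N)%Z by rewrite p2; apply: dvdz_trans u6_dvd.
have -> : (3 * r = 6 * s)%N by rewrite rE (mulnC s) mulnA.
rewrite logn_lucas_mul //; last by rewrite p2 expr1 dvdz_mulr.
rewrite lognM // nu2_u // addnA; congr (_ + _)%N.
have -> : logn p 6 = 1%N by rewrite p2.
by rewrite addn1 prednK // logn_u_gt0.
Qed.
End Valuation.
End Lucas.

(** * Assembling the primes of [k] *)

Theorem theorem1p6 (a b : int) (u : nat -> int)
  (u0 : u 0%N = 0) (u1 : u 1%N = 1)
  (u_rec : forall n : nat, u n.+2 = a * u n.+1 + b * u n)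
  (u_nondeg : lucas_nondegenerate a b)
  (k : nat) (k_gt1 : (1 < k)%N) (k_b : coprimez k%:Z b)
  (n : nat) (n_gt0 : (0 < n)%N) :
  nu k (u n) =
    if (tau u (\prod_(p <- primes k) p)%N %| n)%N
    then nu k (c_k a b u k n * n)%N%:Z
    else 0%N.
Proof.
have u_neq0 m : (0 < m)%N -> u m != 0 by apply: (lucas_neq0 a b).
have k_prime p : p \in primes k -> prime p /\ coprimez p b.
  rewrite mem_primes => /and3P[p_pr _ p_k]; split=> //.
  by rewrite coprimezE (coprime_dvdl p_k).
have rad_gt0 : (0 < \prod_(p <- primes k) p)%N.
  by rewrite big_seq; apply: prodn_cond_gt0 => p /k_prime[/prime_gt0].
have rad_b : coprimez (\prod_(p <- primes k) p)%N b.
  rewrite coprimezE /= big_seq; elim/big_ind: _ => [|x y cx cy|p].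
  - exact: coprime1n.
  - by rewrite coprimeMl cx.
  - by case/k_prime.
rewrite -(tau_dvdP a b) // dvdz_prod_primes; case: allP => [all_dvd|not_all].
  have c_gt0 : (0 < c_k a b u k n)%N.
    rewrite /c_k big_seq; apply: prodn_cond_gt0 => p /k_prime[p_pr _].
    by rewrite expn_gt0 prime_gt0.
  apply: eq_nu; rewrite ?u_neq0 //.
    by rewrite eqz_nat -lt0n muln_gt0 c_gt0.
  move=> p p_k; have [p_pr p_b] := k_prime p p_k.
  rewrite (logn_lucas a b) //; last exact: all_dvd.
  by rewrite lognM // /c_k logn_prod_primes.
apply: nu_ndvd; rewrite ?u_neq0 //; apply/negP => k_un; apply: not_all => p.
rewrite mem_primes => /and3P[_ _ p_k].
by apply: dvdz_trans k_un; rewrite dvdzE.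
Qed.
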